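(* Let $\mathfrak{a}$ and $\mathfrak{b}$ be small $k$-linear categories. Let $\mathcal{T}_{\mathfrak{a}}$ be a topology on $\mathfrak{a}$ with corresponding localizing Serre subcategory $\mathcal{W}_{\mathfrak{a}} \subseteq \mathrm{Mod}(\mathfrak{a})$, and let $\mathcal{T}_{\mathfrak{b}}$ be a topology on $\mathfrak{b}$ with corresponding localizing Serre subcategory $\mathcal{W}_{\mathfrak{b}} \subseteq \mathrm{Mod}(\mathfrak{b})$. Then the topology $\mathcal{T}_{\mathfrak{a}} \boxtimes \mathcal{T}_{\mathfrak{b}}$ on $\mathfrak{a} \otimes \mathfrak{b}$ and the localizing Serre subcategory $\mathcal{W}_{\mathfrak{a}} \boxtimes \mathcal{W}_{\mathfrak{b}}$ of $\mathrm{Mod}(\mathfrak{a} \otimes \mathfrak{b})$ correspond to each other under the order isomorphism between topologies on $\mathfrak{a} \otimes \mathfrak{b}$ and localizing Serre subcategories of $\mathrm{Mod}(\mathfrak{a} \otimes \mathfrak{b})$.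
   Context: $k$ is a commutative ring; all categories and functors are $k$-linear. For a small $k$-linear category $\mathfrak{a}$, $\mathrm{Mod}(\mathfrak{a})$ is the category of $k$-linear functors $\mathfrak{a}^{\mathrm{op}} \to \mathrm{Mod}(k)$. The tensor product $\mathfrak{a} \otimes \mathfrak{b}$ has objects the pairs $(A,B)$ and $(\mathfrak{a} \otimes \mathfrak{b})((A',B'),(A,B)) = \mathfrak{a}(A',A) \otimes_k \mathfrak{b}(B',B)$. A sieve on $A \in \mathfrak{a}$ is a submodule $R \subseteq \mathfrak{a}(-,A)$; for $f : A' \to A$, $f^{-1}R = \{g \mid fg \in R\}$ is a sieve on $A'$. A (linear) topology $\mathcal{T}$ on $\mathfrak{a}$ specifies for every $A$ a collection $\mathcal{T}(A)$ of (covering) sieves on $A$ such that: $\mathfrak{a}(-,A) \in \mathcal{T}(A)$ (identity); $R \in \mathcal{T}(A)$ and $f : A' \to A$ imply $f^{-1}R \in \mathcal{T}(A')$ (pullback); if $R \in \mathcal{T}(A)$ and $S$ is a sieve on $A$ with $f^{-1}S \in \mathcal{T}(A')$ for all $f \in R(A')$ and all $A'$, then $S \in \mathcal{T}(A)$ (glueing). A localizing Serre subcategory of $\mathrm{Mod}(\mathfrak{a})$ is a full subcategory closed under subquotients, extensions and coproducts. Topologies on $\mathfrak{a}$ and localizing Serre subcategories of $\mathrm{Mod}(\mathfrak{a})$ correspond via inverse order isomorphisms: $\mathcal{T}$ corresponds to the full subcategory of null presheaves, i.e. those $F$ such that for all $x \in F(A)$ there is $R \in \mathcal{T}(A)$ with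 $F(f)(x) = 0$ for all $f \in R(A')$; and $\mathcal{W}$ corresponds to the topology for which $R$ covers $A$ iff $\mathfrak{a}(-,A)/R \in \mathcal{W}$. For sieves $R$ on $A$ and $S$ on $B$, $R \boxtimes S$ is the image of the canonical map $R \otimes S \to (\mathfrak{a} \otimes \mathfrak{b})(-,(A,B))$, where $(R\otimes S)(A',B') = R(A')\otimes_k S(B')$. The topology $\mathcal{T}_{\mathfrak{a}} \boxtimes \mathcal{T}_{\mathfrak{b}}$ is the smallest topology on $\mathfrak{a} \otimes \mathfrak{b}$ containing all sieves $R \boxtimes \mathfrak{b}(-,B)$ with $R \in \mathcal{T}_{\mathfrak{a}}(A)$, $B \in \mathfrak{b}$, and all sieves $\mathfrak{a}(-,A) \boxtimes S$ with $A \in \mathfrak{a}$, $S \in \mathcal{T}_{\mathfrak{b}}(B)$. Put $\mathcal{W}_1 = \{F \in \mathrm{Mod}(\mathfrak{a} \otimes \mathfrak{b}) \mid F(-,B) \in \mathcal{W}_{\mathfrak{a}}\ \forall B \in \mathfrak{b}\}$ and $\mathcal{W}_2 = \{F \in \mathrm{Mod}(\mathfrak{a} \otimes \mathfrak{b}) \mid F(A,-) \in \mathcal{W}_{\mathfrak{b}}\ \forall A \in \mathfrak{a}\}$. Then $\mathcal{W}_{\mathfrak{a}} \boxtimes \mathcal{W}_{\mathfrak{b}} = \mathcal{W}_1 \vee \mathcal{W}_2$ is the smallest localizing Serre subcategory of $\mathrm{Mod}(\mathfrak{a} \otimes \mathfrak{b})$ containing $\mathcal{W}_1$ and $\mathcal{W}_2$.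 *)

(* Defs.v *)
From HB Require Import structures.
From mathcomp Require Import all_boot all_algebra generic_quotient ring_quotient.
From mathcomp Require Import boolp.

Set Implicit Arguments.
Unset Strict Implicit.
Unset Printing Implicit Defensive.

Import GRing.Theory.
Local Open Scope ring_scope.
Local Open Scope quotient_scope.

Section Submodules.
Context {k : comPzRingType}.

Record submod (V : lmodType k) := Submod {
  smem :> V -> Prop;
  smem0 : smem 0;
  smemP : forall (c : k) (x y : V), smem x -> smem y -> smem (c *: x + y)
}.

(* The boolean form of membership connects [submod] to the library's
   [submodClosed] predicates, hence to its subtypes and quotients. *)
Definition smemb (V : lmodType k) (S : submod V) : V -> bool :=
  fun x => `[< S x >].

Lemma smemb_closed (V : lmodType k) (S : submod V) :
  GRing.subsemimod_closed (smemb S).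
Proof.
have S0 : S 0 := smem0 S.
split; first split.
- by rewrite /in_mem /=; apply/asboolP.
- move=> x y; rewrite /in_mem /= => /asboolP Sx /asboolP Sy; apply/asboolP.
  by rewrite -[x]scale1r; apply: smemP.
- move=> c x; rewrite /in_mem /= => /asboolP Sx; apply/asboolP.
  by rewrite -[c *: x]addr0; apply: smemP.
Qed.

HB.instance Definition _ (V : lmodType k) (S : submod V) :=
  GRing.isSubmodClosed.Build k V (smemb S) (smemb_closed S).

Definition smod (V : lmodType k) (S : submod V) := {x : V | smemb S x}.

HB.instance Definition _ (V : lmodType k) (S : submod V) :=
  SubChoice.on (smod S).
HB.instance Definition _ (V : lmodType k) (S : submod V) :=
  [SubChoice_isSubLmodule of smod S by <:].

Definition smemz (V : lmodType k) (S : submod V) : zmodClosed V :=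
  GRing.ZmodClosed.clone V (smemb S) _.

Definition qmod (V : lmodType k) (S : submod V) : Type :=
  Quotient.quot (smemz S).

HB.instance Definition _ (V : lmodType k) (S : submod V) :=
  GRing.Zmodule.on (qmod S).

Definition qproj (V : lmodType k) (S : submod V) (x : V) : qmod S :=
  \pi_(Quotient.quot (smemz S)) x.

Lemma qprojK (V : lmodType k) (S : submod V) (q : qmod S) :
  qproj S (repr (q : Quotient.quot (smemz S))) = q.
Proof. exact: reprK. Qed.

Lemma qprojD (V : lmodType k) (S : submod V) (x y : V) :
  qproj S (x + y) = qproj S x + qproj S y.
Proof. by rewrite /qproj !piE. Qed.

Lemma qproj_eq (V : lmodType k) (S : submod V) (x y : V) :
  qproj S x = qproj S y <-> S (x - y).
Proof.
have e : (x == y %[mod Quotient.quot (smemz S)]) = smemb S (x - y).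
  by rewrite -Quotient.idealrBE.
split=> [/eqP|Sxy]; first by rewrite /qproj e => /asboolP.
by apply/eqP; rewrite /qproj e; apply/asboolP.
Qed.

(* Defined through representatives, hence only meaningful when f is linear and
   maps S into T, see [qmapE]. *)
Definition qmap (V W : lmodType k) (S : submod V) (T : submod W) (f : V -> W)
    (q : qmod S) : qmod T :=
  qproj T (f (repr (q : Quotient.quot (smemz S)))).

Lemma qmapE (V W : lmodType k) (S : submod V) (T : submod W) (f : V -> W) :
  linear f -> (forall x, S x -> T (f x)) ->
  forall x, qmap T f (qproj S x) = qproj T (f x).
Proof.
move=> lf fS x; apply/qproj_eq.
set y := repr _.
have /qproj_eq Sxy : qproj S y = qproj S x by rewrite qprojK.
have -> : f y - f x = f (y - x).
  by rewrite [y - x]addrC -[- x]scaleN1r lf scaleN1r addrC.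
exact: fS.
Qed.

Section QuotientScale.
Variables (V : lmodType k) (S : submod V).

Definition qscale (c : k) : qmod S -> qmod S := qmap S ( *:%R c).

Lemma qscaleE c x : qscale c (qproj S x) = qproj S (c *: x).
Proof.
apply: qmapE => [a u v|u Su]; first by rewrite scalerDr !scalerA mulrC.
by rewrite -[c *: u]addr0; apply: smemP (smem0 S).
Qed.

Fact qscaleA c d q : qscale c (qscale d q) = qscale (c * d) q.
Proof. by rewrite -(qprojK q) !qscaleE scalerA. Qed.

Fact qscale1 : left_id 1 qscale.
Proof. by move=> q; rewrite -(qprojK q) qscaleE scale1r. Qed.

Fact qscaleDr : right_distributive qscale +%R.
Proof.
move=> c q r; rewrite -(qprojK q) -(qprojK r).
by rewrite -qprojD !qscaleE scalerDr qprojD.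
Qed.

Fact qscaleDl q : {morph qscale^~ q : c d / c + d}.
Proof. by move=> c d; rewrite -(qprojK q) !qscaleE scalerDl qprojD. Qed.

HB.instance Definition _ := GRing.Zmodule_isLmodule.Build k (qmod S)
  qscaleA qscale1 qscaleDr qscaleDl.

Lemma qproj_linear : linear (qproj S).
Proof. by move=> c x y; rewrite qprojD -qscaleE. Qed.

End QuotientScale.

End Submodules.

Section Tensor.
Context {k : comPzRingType}.

Definition kbilinear (M N P : lmodType k) (f : M -> N -> P) : Prop :=
  (forall x, linear (f x)) /\ (forall y, linear (f^~ y)).

Section LinearFun.
Variables (P Q : lmodType k) (g : P -> Q).
Hypothesis lg : linear g.

Lemma linear_fun0 : g 0 = 0.
Proof. by have := lg (-1) 0 0; rewrite scaler0 addr0 scaleN1r addNr. Qed.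

Lemma linear_funZ c x : g (c *: x) = c *: g x.
Proof. by have := lg c x 0; rewrite !addr0 linear_fun0 addr0. Qed.

Lemma linear_funD x y : g (x + y) = g x + g y.
Proof. by have := lg 1 x y; rewrite !scale1r. Qed.

End LinearFun.

Section TensorProduct.
Variables M N : lmodType k.

(* M (x) N as formal sums of pure tensors modulo the bilinear relations.
   No formal negatives or coefficients are needed: the pair (c *: x, y) plays
   the role of c (x (x) y). *)
Inductive tens_eq : seq (M * N) -> seq (M * N) -> Prop :=
| TensRefl s : tens_eq s s
| TensSym s t : tens_eq s t -> tens_eq t s
| TensTrans s t u : tens_eq s t -> tens_eq t u -> tens_eq s u
| TensCat s s' t t' : tens_eq s s' -> tens_eq t t' -> tens_eq (s ++ t) (s' ++ t')
| TensComm s t : tens_eq (s ++ t) (t ++ s)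
| TensDl x x' y : tens_eq [:: (x + x', y)] [:: (x, y); (x', y)]
| TensDr x y y' : tens_eq [:: (x, y + y')] [:: (x, y); (x, y')]
| TensZ c x y : tens_eq [:: (c *: x, y)] [:: (x, c *: y)]
| Tens0 y : tens_eq [:: (0, y)] [::].

Definition tens_eqb : rel (seq (M * N)) := fun s t => `[< tens_eq s t >].

Fact tens_eqb_equiv : equiv_class_of tens_eqb.
Proof.
split=> [s|s t|t s u].
- by apply/asboolP; exact: TensRefl.
- by apply/asboolP/asboolP; exact: TensSym.
- by move=> /asboolP st /asboolP tu; apply/asboolP; exact: TensTrans tu.
Qed.

Canonical tens_eqb_equivRel := EquivRelPack tens_eqb_equiv.
Canonical tens_eqb_encModRel := defaultEncModRel tens_eqb.

Definition tensor : Type := {eq_quot tens_eqb}.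

HB.instance Definition _ := Choice.on tensor.

Definition tcls (s : seq (M * N)) : tensor := \pi_({eq_quot tens_eqb}) s.
Definition trep (t : tensor) : seq (M * N) := repr (t : {eq_quot tens_eqb}).

Lemma trepK t : tcls (trep t) = t.
Proof. exact: reprK. Qed.

Lemma tclsP s t : tcls s = tcls t <-> tens_eq s t.
Proof.
have e : (s == t %[mod {eq_quot tens_eqb}]) = tens_eqb s t by rewrite piE.
split=> [/eqP|st]; first by rewrite /tcls e => /asboolP.
by apply/eqP; rewrite /tcls e; apply/asboolP.
Qed.

Lemma trep_tcls s : tens_eq (trep (tcls s)) s.
Proof. by apply/tclsP; rewrite trepK. Qed.

Definition pure (x : M) (y : N) : tensor := tcls [:: (x, y)].

Definition tadd (t u : tensor) : tensor := tcls (trep t ++ trep u).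
Definition tscale (c : k) (t : tensor) : tensor :=
  tcls [seq (c *: p.1, p.2) | p <- trep t].

Lemma taddE s t : tadd (tcls s) (tcls t) = tcls (s ++ t).
Proof. by apply/tclsP; apply: TensCat; apply: trep_tcls. Qed.

Lemma tens_eq_scale c s t : tens_eq s t ->
  tens_eq [seq (c *: p.1, p.2) | p <- s] [seq (c *: p.1, p.2) | p <- t].
Proof.
elim=> [{}s|{}s {}t _|{}s {}t u _ st _|{}s s' {}t t' _ ss' _ tt'|{}s {}t
       |x x' y|x y y'|d x y|y] /=.
- exact: TensRefl.
- exact: TensSym.
- exact: TensTrans st.
- by rewrite !map_cat; apply: TensCat.
- by rewrite !map_cat; apply: TensComm.
- by rewrite scalerDr; apply: TensDl.
- exact: TensDr.
- by rewrite scalerA mulrC -scalerA; apply: TensZ.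
- by rewrite scaler0; apply: Tens0.
Qed.

Lemma tscaleE c s : tscale c (tcls s) = tcls [seq (c *: p.1, p.2) | p <- s].
Proof. by apply/tclsP; apply: tens_eq_scale; apply: trep_tcls. Qed.

Lemma tens_ind (P : tensor -> Prop) : P (tcls [::]) ->
  (forall x y t, P t -> P (tadd (pure x y) t)) -> forall t, P t.
Proof.
move=> P0 PS t; rewrite -(trepK t); elim: (trep t) => // -[x y] s IHs.
by rewrite -[_ :: s]/([:: (x, y)] ++ s) -taddE; apply: PS.
Qed.

Fact taddA : associative tadd.
Proof.
by move=> t u v; rewrite -(trepK t) -(trepK u) -(trepK v) !taddE catA.
Qed.

Fact taddC : commutative tadd.
Proof.
move=> t u; rewrite -(trepK t) -(trepK u) !taddE.
by apply/tclsP; apply: TensComm.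
Qed.

Fact tadd0 : left_id (tcls [::]) tadd.
Proof. by move=> t; rewrite -(trepK t) taddE. Qed.

Lemma tscaleD c t u : tscale c (tadd t u) = tadd (tscale c t) (tscale c u).
Proof.
by rewrite -(trepK t) -(trepK u) taddE !tscaleE taddE map_cat.
Qed.

Lemma tscale_pure c x y : tscale c (pure x y) = pure (c *: x) y.
Proof. exact: tscaleE. Qed.

Lemma tscaleDl t c d : tscale (c + d) t = tadd (tscale c t) (tscale d t).
Proof.
elim/tens_ind: t => [|x y t IHt]; first by rewrite !tscaleE /= tadd0.
rewrite !tscaleD IHt !tscale_pure.
have -> : pure ((c + d) *: x) y = tadd (pure (c *: x) y) (pure (d *: x) y).
  by rewrite taddE scalerDl; apply/tclsP; apply: TensDl.
by rewrite -!taddA; congr tadd; rewrite taddA [tadd _ (tscale c t)]taddC taddA.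
Qed.

Fact taddN : left_inverse (tcls [::]) (tscale (-1)) tadd.
Proof.
move=> t; elim/tens_ind: t => [|x y t IHt]; first by rewrite tscaleE tadd0.
rewrite tscaleD taddA -[tadd (tadd _ _) (pure x y)]taddA.
rewrite [tadd (tscale _ t) _]taddC taddA tscale_pure -[tadd _ t]taddA IHt.
rewrite taddC tadd0 taddE -[RHS](_ : pure 0 y = _); last first.
  by apply/tclsP; apply: Tens0.
apply/tclsP; rewrite -(addNr x) scaleN1r; exact/TensSym/TensDl.
Qed.

HB.instance Definition _ :=
  GRing.isZmodule.Build tensor taddA taddC tadd0 taddN.

Fact tscaleA c d t : tscale c (tscale d t) = tscale (c * d) t.
Proof.
rewrite -(trepK t) !tscaleE -map_comp; congr tcls.
by apply: eq_map => p /=; rewrite scalerA.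
Qed.

Fact tscale1 : left_id 1 tscale.
Proof.
move=> t; rewrite -{2}(trepK t) /tscale; congr tcls.
by rewrite -[RHS]map_id; apply: eq_map => -[x y] /=; rewrite scale1r.
Qed.

Fact tscaleDr : right_distributive tscale +%R.
Proof. by move=> c t u; apply: tscaleD. Qed.

HB.instance Definition _ := GRing.Zmodule_isLmodule.Build k tensor
  tscaleA tscale1 tscaleDr tscaleDl.

Lemma pure_bilinear : kbilinear pure.
Proof.
split=> [x c y y'|y c x x'].
  rewrite -[c *: pure x y]/(tscale c _) tscale_pure.
  transitivity (pure x (c *: y) + pure x y').
    rewrite -[RHS]/(tadd _ _) taddE; apply/tclsP; exact: TensDr.
  by congr (_ + _); apply/tclsP; apply/TensSym/TensZ.
rewrite -[c *: pure x y]/(tscale c _) tscale_pure.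
by rewrite -[RHS]/(tadd _ _) taddE; apply/tclsP; apply: TensDl.
Qed.

Lemma tensor_ind (P : tensor -> Prop) : P 0 ->
  (forall x y t, P t -> P (pure x y + t)) -> forall t, P t.
Proof. exact: tens_ind. Qed.

(* Defined through representatives, hence only meaningful for bilinear f, for
   which it is the induced linear map: see [tliftE], [tlift_linear] and, for
   its uniqueness, [tensor_ext]. *)
Definition tlift (P : lmodType k) (f : M -> N -> P) (t : tensor) : P :=
  \sum_(p <- trep t) f p.1 p.2.

Section Lift.
Variables (P : lmodType k) (f : M -> N -> P).
Hypothesis fbil : kbilinear f.

Lemma tlift_cls s : tlift f (tcls s) = \sum_(p <- s) f p.1 p.2.
Proof.
have [fr fl] := fbil.
rewrite /tlift; move: (trep_tcls s); move: (trep _) => u; move: s.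
move=> s us; elim: u s / us => [//|s t _ -> //|s t u _ -> _ -> //
  |s1 s2 t1 t2 _ IHs _ IHt|s1 s2|x x' y|x y y'|c x y|y].
- by rewrite !big_cat IHs IHt.
- by rewrite !big_cat /= addrC.
- by rewrite !big_cons !big_nil !addr0; apply: (linear_funD (fl y)).
- by rewrite !big_cons !big_nil !addr0; apply: (linear_funD (fr x)).
- rewrite !big_cons !big_nil !addr0 /= (linear_funZ (fr x)).
  exact: (linear_funZ (fl y)).
- by rewrite big_cons big_nil addr0; apply: (linear_fun0 (fl y)).
Qed.

Lemma tliftE x y : tlift f (pure x y) = f x y.
Proof. by rewrite tlift_cls big_cons big_nil addr0. Qed.

Lemma tlift_linear : linear (tlift f).
Proof.
have [_ fl] := fbil.
move=> c t u; rewrite -(trepK t) -(trepK u).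
rewrite -[c *: _]/(tscale c _) tscaleE -[_ + _]/(tadd _ _) taddE !tlift_cls.
rewrite big_cat big_map scaler_sumr /=; congr (_ + _).
by apply: eq_bigr => p _; apply: (linear_funZ (fl p.2)).
Qed.

End Lift.

Lemma tensor_ext (P : lmodType k) (g h : tensor -> P) :
  linear g -> linear h -> (forall x y, g (pure x y) = h (pure x y)) -> g =1 h.
Proof.
move=> lg lh gh; elim/tensor_ind => [|x y t IHt]; first by rewrite !linear_fun0.
by rewrite !linear_funD // gh IHt.
Qed.

End TensorProduct.

Section TensorMap.
Variables (M M' N N' : lmodType k) (f : M -> M') (g : N -> N').

Definition tmap : tensor M N -> tensor M' N' :=
  tlift (fun x y => pure (f x) (g y)).

Hypotheses (lf : linear f) (lg : linear g).

Lemma tmap_bilinear : kbilinear (fun x y => pure (f x) (g y)).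
Proof.
have [pr pl] := pure_bilinear M' N'.
split=> [x c y y'|y c x x'] /=; first by rewrite lg pr.
by rewrite lf; apply: pl.
Qed.

Lemma tmapE x y : tmap (pure x y) = pure (f x) (g y).
Proof. exact: (tliftE tmap_bilinear). Qed.

Lemma tmap_linear : linear tmap.
Proof. exact: (tlift_linear tmap_bilinear). Qed.

End TensorMap.

End Tensor.

Record klincat (k : comPzRingType) := KLinCat {
  ob :> Type;
  hom : ob -> ob -> lmodType k;
  idm : forall A, hom A A;
  comp : forall A B C, hom B C -> hom A B -> hom A C;
  comp_bilinear : forall A B C, kbilinear (@comp A B C);
  compA : forall A B C D (f : hom C D) (g : hom B C) (h : hom A B),
    comp f (comp g h) = comp (comp f g) h;
  comp1m : forall A B (f : hom A B), comp (idm B) f = f;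
  compm1 : forall A B (f : hom A B), comp f (idm A) = f
}.

Arguments hom {k} c A B : rename.
Arguments idm {k c} A : rename.
Arguments comp {k c A B C} f g : rename.

Notation "f \c g" := (comp f g) (at level 40, left associativity).

Section Modules.
Context {k : comPzRingType} (a : klincat k).

Record kmod := KMod {
  mob :> a -> lmodType k;
  mact : forall A' A, hom a A' A -> mob A -> mob A';
  mact_bilinear : forall A' A, kbilinear (@mact A' A);
  mact1 : forall A (x : mob A), mact (idm A) x = x;
  mactM : forall A'' A' A (f : hom a A' A) (g : hom a A'' A') (x : mob A),
    mact (f \c g) x = mact g (mact f x)
}.

Record kmor (F G : kmod) := KMor {
  kmap :> forall A, F A -> G A;
  kmap_linear : forall A, linear (@kmap A);
  kmap_nat : forall A' A (f : hom a A' A) (x : F A),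
    kmap (mact f x) = mact f (kmap x)
}.

(* Kernels and images in Mod(a) are computed pointwise, so monomorphisms,
   epimorphisms and exactness are stated pointwise. *)
Definition kmono (F G : kmod) (i : kmor F G) := forall A, injective (i A).
Definition kepi (F G : kmod) (p : kmor F G) :=
  forall A (y : G A), exists x, p A x = y.

Definition short_exact (F G H : kmod) (i : kmor F G) (p : kmor G H) :=
  [/\ kmono i, kepi p &
      forall A (y : G A), p A y = 0 <-> exists x, i A x = y].

Definition is_coproduct (I : Type) (F : I -> kmod) (C : kmod)
    (inj : forall i, kmor (F i) C) :=
  forall (G : kmod) (g : forall i, kmor (F i) G),
  exists h : kmor C G,
    (forall i A (x : F i A), h A (inj i A x) = g i A x) /\
    (forall h' : kmor C G,
       (forall i A (x : F i A), h' A (inj i A x) = g i A x) ->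
       forall A (y : C A), h' A y = h A y).

(* Closure under isomorphisms is a case of [loc_sub]; the zero module belongs to
   the subcategory as the empty coproduct. *)
Record localizing := Localizing {
  lmem :> kmod -> Prop;
  loc_sub : forall (F G : kmod) (i : kmor F G), kmono i -> lmem G -> lmem F;
  loc_quot : forall (F G : kmod) (p : kmor F G), kepi p -> lmem F -> lmem G;
  loc_ext : forall (F G H : kmod) (i : kmor F G) (p : kmor G H),
    short_exact i p -> lmem F -> lmem H -> lmem G;
  loc_coprod : forall (I : Type) (F : I -> kmod) (C : kmod)
      (inj : forall i, kmor (F i) C),
    is_coproduct inj -> (forall i, lmem (F i)) -> lmem C
}.

Section GeneratedLocalizing.
Variable P : kmod -> Prop.

Definition loc_gen_mem (F : kmod) : Prop :=
  forall W : localizing, (forall G, P G -> W G) -> W F.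

Fact loc_gen_sub F G (i : kmor F G) :
  kmono i -> loc_gen_mem G -> loc_gen_mem F.
Proof. by move=> im WG W PW; apply: (loc_sub im); apply: WG. Qed.

Fact loc_gen_quot F G (p : kmor F G) :
  kepi p -> loc_gen_mem F -> loc_gen_mem G.
Proof. by move=> pe WF W PW; apply: (loc_quot pe); apply: WF. Qed.

Fact loc_gen_ext F G H (i : kmor F G) (p : kmor G H) :
  short_exact i p -> loc_gen_mem F -> loc_gen_mem H -> loc_gen_mem G.
Proof.
by move=> ip WF WH W PW; apply: (loc_ext ip); [apply: WF | apply: WH].
Qed.

Fact loc_gen_coprod I (F : I -> kmod) C (inj : forall i, kmor (F i) C) :
  is_coproduct inj -> (forall i, loc_gen_mem (F i)) -> loc_gen_mem C.
Proof. by move=> cop WF W PW; apply: (loc_coprod cop) => i; apply: WF. Qed.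

Definition loc_gen : localizing :=
  Localizing loc_gen_sub loc_gen_quot loc_gen_ext loc_gen_coprod.

End GeneratedLocalizing.

Record sieve (A : a) := Sieve {
  sv :> forall A', submod (hom a A' A);
  sv_stable : forall A'' A' (f : hom a A' A) (g : hom a A'' A'),
    sv A' f -> sv A'' (f \c g)
}.

Lemma compl_linear A B C (f : hom a B C) :
  linear (fun g : hom a A B => f \c g).
Proof. exact: (comp_bilinear A B C).1. Qed.

Lemma compr_linear A B C (g : hom a A B) :
  linear (fun f : hom a B C => f \c g).
Proof. exact: (comp_bilinear A B C).2. Qed.

Definition full_sieve (A : a) : sieve A :=
  @Sieve A (fun A' => @Submod k (hom a A' A) (fun=> True) I (fun _ _ _ _ _ => I))
    (fun _ _ _ _ _ => I).

Section PullSieve.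
Variables (A' A : a) (f : hom a A' A) (R : sieve A).

Definition pull_mem A'' (g : hom a A'' A') : Prop := R A'' (f \c g).

Fact pull_mem0 A'' : pull_mem (0 : hom a A'' A').
Proof. by rewrite /pull_mem (linear_fun0 (compl_linear f)); apply: smem0. Qed.

Fact pull_memP A'' c (x y : hom a A'' A') :
  pull_mem x -> pull_mem y -> pull_mem (c *: x + y).
Proof. by move=> Rx Ry; rewrite /pull_mem compl_linear; apply: smemP. Qed.

Fact pull_stable A3 A2 (g : hom a A2 A') (h : hom a A3 A2) :
  pull_mem g -> pull_mem (g \c h).
Proof. by move=> Rg; rewrite /pull_mem compA; apply: sv_stable. Qed.

Definition pull_sieve : sieve A' :=
  @Sieve A' (fun A'' => Submod (@pull_mem0 A'') (@pull_memP A'')) pull_stable.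

End PullSieve.

Record topology := Topology {
  cov :> forall A, sieve A -> Prop;
  cov_id : forall A, cov (full_sieve A);
  cov_pull : forall A (R : sieve A), cov R ->
    forall A' (f : hom a A' A), cov (pull_sieve f R);
  cov_glue : forall A (R S : sieve A), cov R ->
    (forall A' (f : hom a A' A), R A' f -> cov (pull_sieve f S)) -> cov S
}.

Section GeneratedTopology.
Variable P : forall A, sieve A -> Prop.

Definition top_gen_cov (A : a) (R : sieve A) : Prop :=
  forall T : topology, (forall B (S : sieve B), P S -> T B S) -> T A R.

Fact top_gen_id A : top_gen_cov (full_sieve A).
Proof. by move=> T PT; apply: cov_id. Qed.

Fact top_gen_pull A (R : sieve A) : top_gen_cov R ->
  forall A' (f : hom a A' A), top_gen_cov (pull_sieve f R).
Proof. by move=> TR A' f T PT; apply: cov_pull; apply: TR. Qed.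

Fact top_gen_glue A (R S : sieve A) : top_gen_cov R ->
  (forall A' (f : hom a A' A), R A' f -> top_gen_cov (pull_sieve f S)) ->
  top_gen_cov S.
Proof.
by move=> TR TS T PT; apply: (cov_glue (TR T PT)) => A' f Rf; apply: TS.
Qed.

Definition top_gen : topology := Topology top_gen_id top_gen_pull top_gen_glue.

End GeneratedTopology.

Section QuotientBySieve.
Variables (A : a) (R : sieve A).

Definition qact A'' A' (g : hom a A'' A') : qmod (R A') -> qmod (R A'') :=
  qmap (R A'') (fun f => f \c g).

Lemma qactE A'' A' (g : hom a A'' A') f :
  qact g (qproj (R A') f) = qproj (R A'') (f \c g).
Proof.
by apply: qmapE => [|h Rh]; [apply: compr_linear | apply: sv_stable].
Qed.

Fact qact_bilinear A'' A' : kbilinear (@qact A'' A').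
Proof.
split=> [g c q r|q c g h] /=.
  rewrite -(qprojK q) -(qprojK r) -qproj_linear !qactE.
  by rewrite compr_linear qproj_linear.
by rewrite -(qprojK q) !qactE compl_linear qproj_linear.
Qed.

Fact qact1 A' (q : qmod (R A')) : qact (idm A') q = q.
Proof. by rewrite -(qprojK q) qactE compm1. Qed.

Fact qactM A3 A2 A1 (f : hom a A2 A1) (g : hom a A3 A2) (q : qmod (R A1)) :
  qact (f \c g) q = qact g (qact f q).
Proof. by rewrite -(qprojK q) !qactE compA. Qed.

Definition quot_sieve : kmod := KMod qact_bilinear qact1 qactM.

End QuotientBySieve.

Definition null_presheaf (T : topology) (F : kmod) : Prop :=
  forall A (x : F A), exists2 R : sieve A, T A R &
    forall A' (f : hom a A' A), R A' f -> mact f x = 0.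

(* T and W are mapped to each other by the two inverse bijections between
   topologies on a and localizing Serre subcategories of Mod(a). *)
Definition corresponds (T : topology) (W : localizing) : Prop :=
  (forall F, W F <-> null_presheaf T F) /\
  (forall A (R : sieve A), T A R <-> W (quot_sieve R)).

End Modules.

Section TensorCategory.
Context {k : comPzRingType} (a b : klincat k).

Definition tob : Type := a * b.
Definition thom (X Y : tob) : lmodType k :=
  tensor (hom a X.1 Y.1) (hom b X.2 Y.2).

Lemma thom_ind (X Y : tob) (P : thom X Y -> Prop) : P 0 ->
  (forall f g t, P t -> P ((pure f g : thom X Y) + t)) -> forall t, P t.
Proof. exact: tensor_ind. Qed.

Definition tcomp (X Y Z : tob) (t : thom Y Z) (u : thom X Y) : thom X Z :=
  tlift (fun f g => tmap (fun f' => f \c f') (fun g' => g \c g') u) t.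

Lemma tcomp_bil X Y Z (u : thom X Y) : kbilinear (P := thom X Z)
  (fun (f : hom a Y.1 Z.1) (g : hom b Y.2 Z.2) =>
     tmap (fun f' => f \c f') (fun g' => g \c g') u).
Proof.
have lc := @compl_linear k; have [pr pl] := pure_bilinear (hom a X.1 Z.1) (hom b X.2 Z.2).
have E f g f' g' : tmap (fun f' => f \c f') (fun g' => g \c g')
    (pure f' g') = pure (f \c f') (g \c g') :> thom X Z.
  by apply: tmapE; apply: lc.
have L f g : linear (tmap (fun f' => f \c f') (fun g' => g \c g')
    : thom X Y -> thom X Z).
  by apply: tmap_linear; apply: lc.
split=> [f c g h|g c f h] /=; elim/thom_ind: u => [|f' g' u IHu].
- by rewrite !(linear_fun0 (L _ _)) scaler0 addr0.
- rewrite !(linear_funD (L _ _)) IHu !E compr_linear pr.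
  by rewrite scalerDr addrACA.
- by rewrite !(linear_fun0 (L _ _)) scaler0 addr0.
- rewrite !(linear_funD (L _ _)) IHu !E compr_linear.
  by rewrite (pl _ c) scalerDr addrACA.
Qed.

Lemma tcompE X Y Z (f : hom a Y.1 Z.1) (g : hom b Y.2 Z.2) (u : thom X Y) :
  tcomp (pure f g : thom Y Z) u =
  tmap (fun f' => f \c f') (fun g' => g \c g') u.
Proof. exact: (tliftE (@tcomp_bil X Y Z u)). Qed.

Lemma tcomp_pure X Y Z (f : hom a Y.1 Z.1) (g : hom b Y.2 Z.2)
    (f' : hom a X.1 Y.1) (g' : hom b X.2 Y.2) :
  tcomp (pure f g : thom Y Z) (pure f' g' : thom X Y) =
  pure (f \c f') (g \c g').
Proof.
by rewrite tcompE tmapE //; apply: compl_linear.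
Qed.

Lemma tcomp_bilinear X Y Z : kbilinear (@tcomp X Y Z).
Proof.
split=> [t c u v|u]; last exact: (tlift_linear (@tcomp_bil X Y Z u)).
have L w : linear (@tcomp X Y Z ^~ w) by exact: (tlift_linear (@tcomp_bil X Y Z w)).
elim/thom_ind: t => [|f g t IHt].
  by rewrite !(linear_fun0 (L _)) scaler0 addr0.
rewrite !(linear_funD (L _)) IHt scalerDr addrACA; congr (_ + _).
rewrite !tcompE.
by apply: tmap_linear; apply: compl_linear.
Qed.

Let ll X Y Z (u : thom X Y) := (tcomp_bilinear X Y Z).2 u.
Let lr X Y Z (t : thom Y Z) := (tcomp_bilinear X Y Z).1 t.

Definition tidm (X : tob) : thom X X := pure (idm X.1) (idm X.2).

Fact tcompA W X Y Z (t : thom Y Z) (u : thom X Y) (v : thom W X) :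
  tcomp t (tcomp u v) = tcomp (tcomp t u) v.
Proof.
elim/thom_ind: t => [|f g t IHt]; first by rewrite !(linear_fun0 (ll _)).
rewrite !(linear_funD (ll _)) {}IHt; congr (_ + _).
elim/thom_ind: u => [|f' g' u IHu].
  by rewrite !(linear_fun0 (ll _)) !(linear_fun0 (lr _)) !(linear_fun0 (ll _)).
rewrite (linear_funD (ll _)) !(linear_funD (lr _)) (linear_funD (ll _)) {}IHu.
congr (_ + _).
elim/thom_ind: v => [|f'' g'' v IHv]; first by rewrite !(linear_fun0 (lr _)).
by rewrite !(linear_funD (lr _)) IHv !tcomp_pure !compA.
Qed.

Fact tcomp1m X Y (t : thom X Y) : tcomp (tidm Y) t = t.
Proof.
elim/thom_ind: t => [|f g t IHt]; first by rewrite (linear_fun0 (lr _)).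
by rewrite (linear_funD (lr _)) IHt tcomp_pure !comp1m.
Qed.

Fact tcompm1 X Y (t : thom X Y) : tcomp t (tidm X) = t.
Proof.
elim/thom_ind: t => [|f g t IHt]; first by rewrite (linear_fun0 (ll _)).
by rewrite (linear_funD (ll _)) IHt tcomp_pure !compm1.
Qed.

Definition tensor_cat : klincat k :=
  KLinCat tcomp_bilinear tcompA tcomp1m tcompm1.

Section BoxSieve.
Variables (A : a) (B : b) (R : sieve A) (S : sieve B).

(* The canonical map (R (x) S)(A', B') -> (a (x) b)((A', B'), (A, B)). *)
Definition box_map (X : tensor_cat)
    (t : tensor (smod (R X.1)) (smod (S X.2))) : hom tensor_cat X (A, B) :=
  tmap val val t.

Definition box_mem (X : tensor_cat) (x : hom tensor_cat X (A, B)) : Prop :=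
  exists t, box_map (X := X) t = x.

Let val_linear (V : lmodType k) (U : submod V) : linear (val : smod U -> V).
Proof. by move=> c x y. Qed.

Fact box_mem0 X : box_mem (0 : hom tensor_cat X (A, B)).
Proof. by exists 0; apply/linear_fun0/tmap_linear; apply: val_linear. Qed.

Fact box_memP X c (x y : hom tensor_cat X (A, B)) :
  box_mem x -> box_mem y -> box_mem (c *: x + y).
Proof.
move=> [t <-] [u <-]; exists (c *: t + u).
by apply: tmap_linear; apply: val_linear.
Qed.

Lemma box_memD X (x y : hom tensor_cat X (A, B)) :
  box_mem x -> box_mem y -> box_mem (x + y).
Proof. by rewrite -[x in x + y]scale1r; apply: box_memP. Qed.

Fact box_stable Y X (x : hom tensor_cat X (A, B)) (y : hom tensor_cat Y X) :
  box_mem x -> box_mem (x \c y).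
Proof.
have lt := tmap_linear (@val_linear _ (R X.1)) (@val_linear _ (S X.2)).
move=> [t <-].
elim/(@tensor_ind k (smod (R X.1)) (smod (S X.2))): t => [|r s t IHt].
  by rewrite /box_map (linear_fun0 lt) (linear_fun0 (compr_linear _)); apply: box_mem0.
rewrite /box_map (linear_funD lt) (linear_funD (compr_linear _)).
apply: box_memD => {t IHt} //.
rewrite tmapE; try exact: val_linear.
elim/thom_ind: y => [|f g y IHy].
  by rewrite (linear_fun0 (compl_linear _)); apply: box_mem0.
rewrite (linear_funD (compl_linear _)); apply: box_memD => {y IHy} //.
rewrite [_ \c _]tcomp_pure.
have Rf : smemb (R Y.1) (val r \c f).
  by apply/asboolP/sv_stable; apply/asboolP; apply: (valP r).
have Sg : smemb (S Y.2) (val s \c g).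
  by apply/asboolP/sv_stable; apply/asboolP; apply: (valP s).
exists (pure (Sub _ Rf) (Sub _ Sg)).
by rewrite /box_map tmapE; try exact: val_linear.
Qed.

Definition box_sieve : @sieve k tensor_cat (A, B) :=
  @Sieve k tensor_cat (A, B)
    (fun X => Submod (@box_mem0 X) (@box_memP X)) box_stable.

End BoxSieve.

Inductive box_gen (Ta : topology a) (Tb : topology b) :
    forall X : tensor_cat, sieve X -> Prop :=
| BoxGenL A B (R : sieve A) : Ta A R ->
    box_gen Ta Tb (box_sieve R (full_sieve B))
| BoxGenR A B (S : sieve B) : Tb B S ->
    box_gen Ta Tb (box_sieve (full_sieve A) S).

Definition box_top (Ta : topology a) (Tb : topology b) : topology tensor_cat :=
  top_gen (box_gen Ta Tb).

Section Restriction.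
Variable F : kmod tensor_cat.

Let Fl (X Y : tensor_cat) (x : F Y) := (@mact_bilinear _ _ F X Y).2 x.
Let Fr (X Y : tensor_cat) (t : hom tensor_cat X Y) :=
  (@mact_bilinear _ _ F X Y).1 t.

Section RestrictLeft.
Variable B : b.

Definition resl_act A' A (f : hom a A' A) : F (A, B) -> F (A', B) :=
  mact (pure f (idm B) : hom tensor_cat (A', B) (A, B)).

Fact resl_bilinear A' A : kbilinear (@resl_act A' A).
Proof.
split=> [f|x c f g]; first exact: Fr.
rewrite /resl_act -(Fl x); congr mact.
exact: (pure_bilinear _ _).2.
Qed.

Fact resl1 A (x : F (A, B)) : resl_act (idm A) x = x.
Proof. exact: (mact1 (k := k) (a := tensor_cat)). Qed.

Fact reslM A'' A' A (f : hom a A' A) (g : hom a A'' A') (x : F (A, B)) :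
  resl_act (f \c g) x = resl_act g (resl_act f x).
Proof.
rewrite /resl_act -mactM; congr mact.
by rewrite [_ \c _ in RHS]tcomp_pure comp1m.
Qed.

Definition resl : kmod a :=
  @KMod k a (fun A => F (A, B)) resl_act resl_bilinear resl1 reslM.

End RestrictLeft.

Section RestrictRight.
Variable A : a.

Definition resr_act B' B (g : hom b B' B) : F (A, B) -> F (A, B') :=
  mact (pure (idm A) g : hom tensor_cat (A, B') (A, B)).

Fact resr_bilinear B' B : kbilinear (@resr_act B' B).
Proof.
split=> [f|x c f g]; first exact: Fr.
rewrite /resr_act -(Fl x); congr mact.
exact: (pure_bilinear _ _).1.
Qed.

Fact resr1 B (x : F (A, B)) : resr_act (idm B) x = x.
Proof. exact: (mact1 (k := k) (a := tensor_cat)). Qed.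

Fact resrM B'' B' B (f : hom b B' B) (g : hom b B'' B') (x : F (A, B)) :
  resr_act (f \c g) x = resr_act g (resr_act f x).
Proof.
rewrite /resr_act -mactM; congr mact.
by rewrite [_ \c _ in RHS]tcomp_pure comp1m.
Qed.

Definition resr : kmod b :=
  @KMod k b (fun B => F (A, B)) resr_act resr_bilinear resr1 resrM.

End RestrictRight.
End Restriction.

Section BoxLocalizing.
Variables (Wa : localizing a) (Wb : localizing b).

Definition loc1 (F : kmod tensor_cat) : Prop := forall B : b, Wa (resl F B).
Definition loc2 (F : kmod tensor_cat) : Prop := forall A : a, Wb (resr F A).

Definition box_loc : localizing tensor_cat :=
  loc_gen (fun F => loc1 F \/ loc2 F).

End BoxLocalizing.
End TensorCategory.

(* Main.v *)
From HB Require Import structures.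
From mathcomp Require Import all_boot all_algebra.
From mathcomp Require Import generic_quotient boolp.
Require Import Defs.

Set Implicit Arguments.
Unset Strict Implicit.
Unset Printing Implicit Defensive.

Import GRing.Theory.
Local Open Scope ring_scope.
Local Open Scope quotient_scope.

(** The idea is to pass between topologies and localizing subcategories through
    annihilators. The annihilator of an element x of a presheaf F is a sieve,
    and the subpresheaf generated by x is the representable presheaf modulo
    this sieve. Hence F is null for T exactly when all annihilators cover,
    while, for a localizing W, F is in W exactly when all these cyclic
    quotients are in W: cyclic subpresheaves are subobjects, and conversely F
    is a quotient of the coproduct of its cyclic subpresheaves.

    For every T the null presheaves form a localizing subcategory
    ([null_loc]), and R covers iff its quotient is null ([cov_null_quot]). For
    every W the sieves with quotient in W form a topology ([loc_top]), and its
    null presheaves are in W ([null_loc_top]).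

    Let T be the box topology and W the box subcategory; both are generated, so
    each of the two inclusions between W and the null presheaves of T is checked
    on generators. If all F(-, B) are null, then x in F(A, B) is killed by
    R ⊠ b(-, B) for some covering R, since pure tensors f ⊗ g act through f ⊗ 1
    ([null_of_resl]); so W is contained in the null presheaves of T. If R covers
    A, the class of f ⊗ g modulo R ⊠ b(-, B) is killed by all h ⊗ 1 with h in
    the pullback of R along f, so this quotient is null in the first variable
    ([null_resl_quot_box]); so T is contained in the topology of W, and
    presheaves that are null for T are in W. The second variable is symmetric. *)

Lemma linear_funB (k : comPzRingType) (P Q : lmodType k) (g : P -> Q) :
  linear g -> forall x y, g (x - y) = g x - g y.
Proof.
by move=> lg x y; rewrite -scaleN1r linear_funD // linear_funZ // scaleN1r.
Qed.

(** * Direct sums of modules *)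

Section DirectSum.
Context {k : comPzRingType} (I : Type) (V : I -> lmodType k).

Definition eval_seq (P : lmodType k) (g : forall i, V i -> P)
    (s : seq {i : I & V i}) : P :=
  \sum_(p <- s) g (projT1 p) (projT2 p).

(** Two formal sums are identified when no family of linear maps can tell them
    apart. This is the universal property of the direct sum turned into a
    definition; it gives lifting at once, and the module axioms hold because they
    hold after every [dlift]. *)
Definition dsum_eqb : rel {classic seq {i : I & V i}} := fun s t =>
  `[< forall (P : lmodType k) (g : forall i, V i -> P),
      (forall i, linear (g i)) -> eval_seq g s = eval_seq g t >].

Fact dsum_eqb_equiv : equiv_class_of dsum_eqb.
Proof.
split=> [s|s t|t s u].
- exact/asboolP.
- by apply/asboolP/asboolP => st P g lg; rewrite st.
- move=> /asboolP st /asboolP tu; apply/asboolP => P g lg.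
  by rewrite st // tu.
Qed.

Canonical dsum_eqb_equivRel := EquivRelPack dsum_eqb_equiv.
Canonical dsum_eqb_encModRel := defaultEncModRel dsum_eqb.

Definition dsum : Type := {eq_quot dsum_eqb}.

HB.instance Definition _ := Choice.on dsum.

Definition dcls (s : seq {i : I & V i}) : dsum := \pi_({eq_quot dsum_eqb}) s.
Definition drep (t : dsum) : seq {i : I & V i} :=
  repr (t : {eq_quot dsum_eqb}).

Definition dlift (P : lmodType k) (g : forall i, V i -> P) (t : dsum) : P :=
  eval_seq g (drep t).

Lemma dlift_cls (P : lmodType k) (g : forall i, V i -> P) s :
  (forall i, linear (g i)) -> dlift g (dcls s) = eval_seq g s.
Proof.
move=> lg; have: drep (dcls s) == s %[mod {eq_quot dsum_eqb}].
  by apply/eqP; apply: reprK.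
by rewrite piE => /asboolP e; apply: e.
Qed.

(** Every identity in the direct sum is proved by mapping out of it. *)
Lemma dlift_inj (t u : dsum) :
  (forall (P : lmodType k) (g : forall i, V i -> P),
     (forall i, linear (g i)) -> dlift g t = dlift g u) -> t = u.
Proof.
move=> tu; rewrite -[t](reprK (qT := {eq_quot dsum_eqb})).
rewrite -[u](reprK (qT := {eq_quot dsum_eqb})).
by apply/eqP; rewrite piE; apply/asboolP.
Qed.

Definition dzero : dsum := dcls [::].
Definition dadd (t u : dsum) : dsum := dcls (drep t ++ drep u).
Definition dscale (c : k) (t : dsum) : dsum :=
  dcls [seq existT V (projT1 p) (c *: projT2 p) | p <- drep t].

Section LiftOperations.
Variables (P : lmodType k) (g : forall i, V i -> P).
Hypothesis lg : forall i, linear (@g i).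

Lemma dlift0 : dlift g dzero = 0.
Proof. by rewrite dlift_cls // /eval_seq big_nil. Qed.

Lemma dliftD t u : dlift g (dadd t u) = dlift g t + dlift g u.
Proof. by rewrite dlift_cls // /eval_seq big_cat. Qed.

Lemma dliftZ c t : dlift g (dscale c t) = c *: dlift g t.
Proof.
rewrite dlift_cls // /dlift /eval_seq big_map scaler_sumr.
by apply: eq_bigr => p _ /=; apply: (linear_funZ (@lg _)).
Qed.

End LiftOperations.

Fact daddA : associative dadd.
Proof. by move=> t u v; apply: dlift_inj => P g lg; rewrite !dliftD // addrA. Qed.

Fact daddC : commutative dadd.
Proof. by move=> t u; apply: dlift_inj => P g lg; rewrite !dliftD // addrC. Qed.

Fact dadd0 : left_id dzero dadd.
Proof.
by move=> t; apply: dlift_inj => P g lg; rewrite dliftD // dlift0 // add0r.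
Qed.

Fact daddN : left_inverse dzero (dscale (-1)) dadd.
Proof.
move=> t; apply: dlift_inj => P g lg.
by rewrite dliftD // dliftZ // dlift0 // scaleN1r addNr.
Qed.

HB.instance Definition _ := GRing.isZmodule.Build dsum daddA daddC dadd0 daddN.

Fact dscaleA c d t : dscale c (dscale d t) = dscale (c * d) t.
Proof. by apply: dlift_inj => P g lg; rewrite !dliftZ // scalerA. Qed.

Fact dscale1 : left_id 1 dscale.
Proof. by move=> t; apply: dlift_inj => P g lg; rewrite dliftZ // scale1r. Qed.

Fact dscaleDr : right_distributive dscale +%R.
Proof.
move=> c t u; apply: dlift_inj => P g lg.
by rewrite dliftZ // !dliftD // !dliftZ // scalerDr.
Qed.

Fact dscaleDl t : {morph dscale^~ t : c d / c + d}.
Proof.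
move=> c d; apply: dlift_inj => P g lg.
by rewrite dliftD // !dliftZ // scalerDl.
Qed.

HB.instance Definition _ := GRing.Zmodule_isLmodule.Build k dsum
  dscaleA dscale1 dscaleDr dscaleDl.

Definition dinj i (x : V i) : dsum := dcls [:: existT V i x].

Lemma dliftE (P : lmodType k) (g : forall i, V i -> P) i (x : V i) :
  (forall i, linear (g i)) -> dlift g (dinj x) = g i x.
Proof. by move=> lg; rewrite dlift_cls // /eval_seq big_seq1. Qed.

Lemma dlift_linear (P : lmodType k) (g : forall i, V i -> P) :
  (forall i, linear (g i)) -> linear (dlift g).
Proof. by move=> lg c t u; rewrite [LHS]dliftD // dliftZ. Qed.

Lemma dinj_linear i : linear (@dinj i).
Proof.
move=> c x y; apply: dlift_inj => P g lg.
by rewrite [RHS]dliftD // dliftZ // !dliftE // lg.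
Qed.

Lemma dsum_ind (Q : dsum -> Prop) : Q 0 ->
  (forall i (x : V i) t, Q t -> Q (dinj x + t)) -> forall t, Q t.
Proof.
move=> Q0 QD t; rewrite -[t](reprK (qT := {eq_quot dsum_eqb})).
elim: (repr _) => [//|[i x] s IHs].
have -> : \pi_({eq_quot dsum_eqb}) (existT V i x :: s) = dinj x + dcls s.
  apply: dlift_inj => P g lg.
  rewrite [RHS]dliftD // dliftE // [LHS]dlift_cls // dlift_cls //.
  by rewrite /eval_seq big_cons.
exact: QD.
Qed.

Lemma dsum_ext (P : lmodType k) (g h : dsum -> P) : linear g -> linear h ->
  (forall i (x : V i), g (dinj x) = h (dinj x)) -> g =1 h.
Proof.
move=> lg lh gh; elim/dsum_ind => [|i x t IHt]; first by rewrite !linear_fun0.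
by rewrite !linear_funD // gh IHt.
Qed.

End DirectSum.

Section Presheaves.
Context {k : comPzRingType} {c : klincat k}.
Implicit Types (F G H : kmod c) (A B : c).

Lemma mact_linear F A' A (f : hom c A' A) : linear (mact f : F A -> F A').
Proof. exact: (@mact_bilinear _ _ F A' A).1. Qed.

Lemma mact_linearl F A' A (x : F A) : linear (fun f : hom c A' A => mact f x).
Proof. exact: (@mact_bilinear _ _ F A' A).2. Qed.

Lemma mact0 F A' A (f : hom c A' A) : mact f (0 : F A) = 0.
Proof. exact: (linear_fun0 (mact_linear f)). Qed.

Lemma kmap0 F G (g : kmor F G) A : g A 0 = 0.
Proof. exact: (linear_fun0 (@kmap_linear _ _ _ _ g A)). Qed.

(** * Coproducts of presheaves *)

Section Coproduct.
Variables (I : Type) (F : I -> kmod c).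

Local Notation fam A := (fun i => F i A).
Local Notation inj A i x := (@dinj k I (fam A) i x).

Definition coprod_act A' A (f : hom c A' A) :
    dsum (fam A) -> dsum (fam A') :=
  dlift (fun i x => inj A' i (mact f x)).

Lemma coprod_act_family A' A (f : hom c A' A) i :
  linear (fun x : F i A => inj A' i (mact f x)).
Proof. by move=> d x y; rewrite mact_linear; apply: dinj_linear. Qed.

Lemma coprod_act_inj A' A (f : hom c A' A) i (x : F i A) :
  coprod_act f (inj A i x) = inj A' i (mact f x).
Proof. by rewrite /coprod_act dliftE //; apply: coprod_act_family. Qed.

Lemma coprod_act_linear A' A (f : hom c A' A) : linear (coprod_act f).
Proof. by apply: dlift_linear => i; apply: coprod_act_family. Qed.

Fact coprod_act_bilinear A' A : kbilinear (@coprod_act A' A).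
Proof.
split=> [f|t d f g]; first exact: coprod_act_linear.
elim/(@dsum_ind k I (fam A)): t => [|i x t IHt].
  by rewrite !(linear_fun0 (coprod_act_linear _)) scaler0 addr0.
rewrite !(linear_funD (coprod_act_linear _)) IHt !coprod_act_inj.
by rewrite mact_linearl dinj_linear scalerDr addrACA.
Qed.

Fact coprod_act1 A (t : dsum (fam A)) : coprod_act (idm A) t = t.
Proof.
apply: (dsum_ext (V := fam A) (h := id)) t => [||i x] //.
  exact: coprod_act_linear.
by rewrite coprod_act_inj mact1.
Qed.

Fact coprod_actM A'' A' A (f : hom c A' A) (g : hom c A'' A')
    (t : dsum (fam A)) :
  coprod_act (f \c g) t = coprod_act g (coprod_act f t).
Proof.
apply: (dsum_ext (V := fam A) (h := fun t => coprod_act g (coprod_act f t))) t.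
- exact: coprod_act_linear.
- by move=> d t u; rewrite !coprod_act_linear.
- by move=> i x; rewrite !coprod_act_inj mactM.
Qed.

Definition coprod : kmod c := KMod coprod_act_bilinear coprod_act1 coprod_actM.

Definition coprod_inj i : kmor (F i) coprod :=
  @KMor _ _ (F i) coprod (fun A x => inj A i x)
    (fun A => @dinj_linear k I (fam A) i)
    (fun A' A f x => esym (coprod_act_inj f x)).

Lemma coprod_is_coproduct : is_coproduct coprod_inj.
Proof.
move=> G g.
have lg A i : linear (g i A) by apply: kmap_linear.
have lh A : linear (dlift (fun i => g i A) : coprod A -> G A).
  exact: dlift_linear.
have hN A' A (f : hom c A' A) (x : coprod A) :
    dlift (fun i => g i A') (mact f x) = mact f (dlift (fun i => g i A) x).
  apply: (dsum_ext (V := fam A) (g := fun x => dlift _ (coprod_act f x))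
                   (h := fun x => mact f (dlift _ x))) x => [d t u|d t u|i x].
  - by rewrite coprod_act_linear lh.
  - by rewrite lh mact_linear.
  - by rewrite coprod_act_inj !dliftE // kmap_nat.
exists (KMor lh hN); split=> [i A x|h' h'E A y] /=; first exact: dliftE.
apply: (dsum_ext (V := fam A) (g := h' A)) y; [exact: (kmap_linear h')|exact: lh|].
by move=> i x; rewrite dliftE //; apply: h'E.
Qed.

End Coproduct.

(** * Subpresheaves and annihilators *)

Section Subpresheaf.
Variables (F : kmod c) (N : forall A, submod (F A)).
Hypothesis N_stable : forall A' A (f : hom c A' A) (x : F A),
  N A x -> N A' (mact f x).

Lemma sub_act_subproof A' A (f : hom c A' A) (x : smod (N A)) :
  smemb (N A') (mact f (val x)).
Proof. by apply/asboolP/N_stable/asboolP/(valP x). Qed.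

Definition sub_act A' A (f : hom c A' A) (x : smod (N A)) : smod (N A') :=
  Sub _ (sub_act_subproof f x).

Fact sub_act_bilinear A' A : kbilinear (@sub_act A' A).
Proof.
split=> [f d x y|x d f g]; apply: val_inj => /=; first exact: mact_linear.
exact: mact_linearl.
Qed.

Fact sub_act1 A (x : smod (N A)) : sub_act (idm A) x = x.
Proof. by apply: val_inj; rewrite /= mact1. Qed.

Fact sub_actM A'' A' A (f : hom c A' A) (g : hom c A'' A') (x : smod (N A)) :
  sub_act (f \c g) x = sub_act g (sub_act f x).
Proof. by apply: val_inj; rewrite /= mactM. Qed.

Definition subpresheaf : kmod c := KMod sub_act_bilinear sub_act1 sub_actM.

Lemma sub_incl_linear A : linear (val : subpresheaf A -> F A).
Proof. by []. Qed.

Definition sub_incl : kmor subpresheaf F :=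
  @KMor _ _ subpresheaf F (fun A => val) sub_incl_linear
    (fun _ _ _ _ => erefl).

Lemma sub_incl_mono : kmono sub_incl.
Proof. by move=> A; apply: val_inj. Qed.

Section Corestriction.
Variables (G : kmod c) (g : kmor G F).
Hypothesis gN : forall A (x : G A), N A (g A x).

Lemma corestr_subproof A (x : G A) : smemb (N A) (g A x).
Proof. exact/asboolP. Qed.

Definition corestr_map A (x : G A) : subpresheaf A :=
  Sub _ (corestr_subproof x).

Fact corestr_linear A : linear (@corestr_map A).
Proof. by move=> d x y; apply: val_inj; rewrite /= kmap_linear. Qed.

Fact corestr_nat A' A (f : hom c A' A) (x : G A) :
  corestr_map (mact f x) = mact f (corestr_map x).
Proof. by apply: val_inj; rewrite /= kmap_nat. Qed.

Definition corestr : kmor G subpresheaf := KMor corestr_linear corestr_nat.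

End Corestriction.
End Subpresheaf.

Lemma submod_ext (V : lmodType k) (R S : submod V) :
  (forall x, R x <-> S x) -> R = S.
Proof.
case: R S => [R R0 RP] [S S0 SP] /= RS.
have E : R = S by apply/funext => x; apply/propext.
by case: _ / E in S0 SP *; congr Submod; apply: Prop_irrelevance.
Qed.

Lemma sieve_ext A (R S : sieve A) :
  (forall A' (f : hom c A' A), R A' f <-> S A' f) -> R = S.
Proof.
case: R S => [R RS] [S SS] /= E.
have {}E : R = S.
  apply: functional_extensionality_dep => A'.
  by apply: submod_ext => f; apply: E.
by case: _ / E in SS *; congr Sieve; apply: Prop_irrelevance.
Qed.

Section Annihilator.
Variables (F : kmod c) (A : c) (x : F A).

Definition ann_mem A' (f : hom c A' A) : Prop := mact f x = 0.

Fact ann_mem0 A' : ann_mem (0 : hom c A' A).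
Proof. exact: (linear_fun0 (@mact_linearl F A' A x)). Qed.

Fact ann_memP A' d (f g : hom c A' A) :
  ann_mem f -> ann_mem g -> ann_mem (d *: f + g).
Proof. by rewrite /ann_mem mact_linearl => -> ->; rewrite scaler0 addr0. Qed.

Fact ann_stable A'' A' (f : hom c A' A) (g : hom c A'' A') :
  ann_mem f -> ann_mem (f \c g).
Proof.
by rewrite /ann_mem mactM => ->; apply: mact0.
Qed.

Definition ann : sieve A :=
  @Sieve k c A (fun A' => Submod (@ann_mem0 A') (@ann_memP A')) ann_stable.

End Annihilator.

Lemma ann_mact F A' A (f : hom c A' A) (x : F A) :
  ann (mact f x) = pull_sieve f (ann x).
Proof. by apply: sieve_ext => A'' g; rewrite /= /pull_mem /= /ann_mem mactM. Qed.

Lemma ann_quot A (R : sieve A) A' (f : hom c A' A) :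
  ann (qproj (R A') f : quot_sieve R A') = pull_sieve f R.
Proof.
apply: sieve_ext => A'' g; rewrite /= /pull_mem /ann_mem /= qactE.
rewrite -(linear_fun0 (@qproj_linear _ _ (R A''))) -[f \c g in X in _ <-> X]subr0.
exact: qproj_eq.
Qed.

Lemma pull_sieve_idm A (R : sieve A) : pull_sieve (idm A) R = R.
Proof. by apply: sieve_ext => A' f; rewrite /= /pull_mem comp1m. Qed.

(** By Yoneda, the quotient by a sieve is cyclic, generated by the class of the
    identity. *)
Lemma quot_sieve_gen A (R : sieve A) A' (f : hom c A' A) :
  qproj (R A') f = mact f (qproj (R A) (idm A) : quot_sieve R A).
Proof. by rewrite /= qactE comp1m. Qed.

Section ElementMap.
Variables (F : kmod c) (A : c) (x : F A) (R : sieve A).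
Hypothesis Rx : forall A' (f : hom c A' A), R A' f -> mact f x = 0.

(** An element x killed by R is a morphism from the quotient by R, by the Yoneda
    lemma. The definition goes through a representative of the class; see
    [elem_mapE] for its independence from the choice. *)
Definition elem_map A' (q : quot_sieve R A') : F A' :=
  mact (repr (q : Quotient.quot (smemz (R A')))) x.

Lemma elem_mapE A' (f : hom c A' A) : elem_map (qproj (R A') f) = mact f x.
Proof.
apply/eqP; rewrite -subr_eq0 -(linear_funB (@mact_linearl F A' A x)).
by apply/eqP/Rx/qproj_eq; apply: qprojK.
Qed.

Fact elem_map_linear A' : linear (@elem_map A').
Proof.
move=> d q r; rewrite -(qprojK q) -(qprojK r) -qproj_linear !elem_mapE.
exact: mact_linearl.
Qed.

Fact elem_map_nat A'' A' (g : hom c A'' A') (q : quot_sieve R A') :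
  elem_map (mact g q) = mact g (elem_map q).
Proof. by rewrite -(qprojK q) /= qactE !elem_mapE mactM. Qed.

Definition elem_mor : kmor (quot_sieve R) F := KMor elem_map_linear elem_map_nat.

(** When R is exactly the annihilator of x, the quotient by R is the subpresheaf
    generated by x. *)
Lemma elem_mor_mono :
  (forall A' (f : hom c A' A), mact f x = 0 -> R A' f) -> kmono elem_mor.
Proof.
move=> xR A' q r; rewrite -(qprojK q) -(qprojK r) /= !elem_mapE => e.
apply/qproj_eq/xR; rewrite (linear_funB (@mact_linearl F A' A x)).
by rewrite e subrr.
Qed.

Lemma elem_mor_epi :
  (forall A' (y : F A'), exists f : hom c A' A, mact f x = y) -> kepi elem_mor.
Proof.
move=> gen A' y; have [f <-] := gen A' y.
by exists (qproj (R A') f); apply: elem_mapE.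
Qed.

End ElementMap.

Lemma quot_sieve_generated A (R : sieve A) A' (y : quot_sieve R A') :
  exists f : hom c A' A, mact f (qproj (R A) (idm A) : quot_sieve R A) = y.
Proof.
exists (repr (y : Quotient.quot (smemz (R A')))).
by rewrite -quot_sieve_gen qprojK.
Qed.

Lemma quot_sieve_ann_idm A (R : sieve A) A' (f : hom c A' A) :
  mact f (qproj (R A) (idm A) : quot_sieve R A) = 0 <-> R A' f.
Proof.
have e : ann (qproj (R A) (idm A) : quot_sieve R A) = R.
  by rewrite ann_quot pull_sieve_idm.
by have : ann (qproj (R A) (idm A) : quot_sieve R A) A' f <-> R A' f by rewrite e.
Qed.

(** * From topologies to localizing subcategories *)

Section NullPresheaves.
Variable T : topology c.

(** Glueing along R: pulled back along an element of R, a larger sieve becomes the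
    full one. *)
Lemma cov_superset A (R S : sieve A) : T A R ->
  (forall A' (f : hom c A' A), R A' f -> S A' f) -> T A S.
Proof.
move=> TR RS; apply: (cov_glue TR) => A' f Rf.
suff -> : pull_sieve f S = full_sieve A' by apply: cov_id.
by apply: sieve_ext => A'' g; split=> // _; apply/sv_stable/RS.
Qed.

Lemma null_presheafE F :
  null_presheaf T F <-> forall A (x : F A), T A (ann x).
Proof.
split=> [nF A x|nF A x]; last by exists (ann x).
by have [R TR Rx] := nF A x; apply: cov_superset TR _; apply: Rx.
Qed.

Section NullElements.
Variable F : kmod c.

Definition null_elt A (x : F A) : Prop := T A (ann x).

Lemma null_elt0 A : null_elt (0 : F A).
Proof. by apply: cov_superset (cov_id T A) _ => A' f _; apply: mact0. Qed.

Lemma null_eltP A d (x y : F A) :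
  null_elt x -> null_elt y -> null_elt (d *: x + y).
Proof.
move=> Tx Ty; apply: (cov_glue Tx) => A' f fx.
apply: cov_superset (cov_pull Ty f) _ => A'' g gy.
have {}gy : mact (f \c g) y = 0 := gy.
have {}fx : mact f x = 0 := fx.
by rewrite /= /pull_mem /= /ann_mem mact_linear gy mactM fx mact0 scaler0 addr0.
Qed.

Definition null_submod A : submod (F A) := Submod (@null_elt0 A) (@null_eltP A).

Lemma null_elt_stable A' A (f : hom c A' A) (x : F A) :
  null_submod A x -> null_submod A' (mact f x).
Proof. by rewrite /= /null_elt ann_mact => Tx; apply: cov_pull. Qed.

End NullElements.

Fact null_sub F G (i : kmor F G) :
  kmono i -> null_presheaf T G -> null_presheaf T F.
Proof.
move=> im nG A x; have [R TR Rx] := nG A (i A x); exists R => // A' f Rf.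
by apply: im; rewrite kmap_nat Rx // kmap0.
Qed.

Fact null_quot F G (p : kmor F G) :
  kepi p -> null_presheaf T F -> null_presheaf T G.
Proof.
move=> pe nF A y; have [x <-] := pe A y; have [R TR Rx] := nF A x.
by exists R => // A' f Rf; rewrite -kmap_nat Rx // kmap0.
Qed.

(** If R kills the image of y, then each f in R moves y into the subobject, where
    it has a covering annihilator; these covers glue. *)
Fact null_ext F G H (i : kmor F G) (p : kmor G H) :
  short_exact i p -> null_presheaf T F -> null_presheaf T H ->
  null_presheaf T G.
Proof.
move=> [_ _ ip] nF nH; apply/null_presheafE => A y.
have [R TR Rpy] := nH A (p A y); apply: (cov_glue TR) => A' f Rf.
rewrite -ann_mact.
have /ip[x <-] : p A' (mact f y) = 0 by rewrite kmap_nat Rpy.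
have [S TS Sx] := nF A' x; apply: cov_superset TS _ => A'' g Sg /=.
by rewrite /ann_mem -kmap_nat Sx // kmap0.
Qed.

Definition id_mor F : kmor F F :=
  @KMor k c F F (fun=> id) (fun _ _ _ _ => erefl) (fun _ _ _ _ => erefl).

(** The injections land in the subpresheaf N of null elements of C, so by the
    universal property they induce a morphism from C to N; composed with the
    inclusion it agrees with the identity on each injection, hence everywhere,
    and so N is all of C. *)
Fact null_coprod I (F : I -> kmod c) C (inj : forall i, kmor (F i) C) :
  is_coproduct inj -> (forall i, null_presheaf T (F i)) -> null_presheaf T C.
Proof.
move=> cop nF; pose N := subpresheaf (@null_elt_stable C).
have injN i A (x : F i A) : null_submod C A (inj i A x).
  have [R TR Rx] := nF i A x; apply: cov_superset TR _ => A' f Rf.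
  by rewrite /= /ann_mem -kmap_nat Rx // kmap0.
have [h [hE _]] :=
  cop N (fun i => corestr (@null_elt_stable C) (@injN i)).
have lr A : linear (fun y => val (h A y) : C A).
  by move=> d x y; rewrite kmap_linear.
have nr A' A (f : hom c A' A) (y : C A) :
    val (h A' (mact f y)) = mact f (val (h A y)).
  by rewrite kmap_nat.
have [u [_ uU]] := cop C inj.
have e A (y : C A) : y = val (h A y).
  transitivity (u A y); first exact: (uU (id_mor C)).
  by symmetry; apply: (uU (KMor lr nr)) => i B x /=; rewrite hE.
by apply/null_presheafE => A y; rewrite [y]e; apply/asboolP/(valP (h A y)).
Qed.

Definition null_loc : localizing c :=
  Localizing null_sub null_quot null_ext null_coprod.

Lemma cov_null_quot A (R : sieve A) : T A R <-> null_presheaf T (quot_sieve R).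
Proof.
split=> [TR|/null_presheafE/(_ A (qproj (R A) (idm A)))].
  apply/null_presheafE => A' q; rewrite -(qprojK q) ann_quot.
  exact: cov_pull.
by rewrite ann_quot pull_sieve_idm.
Qed.

End NullPresheaves.

(** * From localizing subcategories to topologies *)

Section LocalizingTopology.
Variable W : localizing c.

(** The sum of the morphisms given by all elements of F is an epimorphism onto F
    from a coproduct of quotients by annihilators. *)
Lemma loc_mem_ann F : (forall A (x : F A), W (quot_sieve (ann x))) -> W F.
Proof.
move=> WF; pose I := {A : c & F A}.
pose Q (i : I) := quot_sieve (ann (projT2 i)).
pose g (i : I) : kmor (Q i) F :=
  @elem_mor F (projT1 i) (projT2 i) (ann (projT2 i)) (fun _ _ => id).
have cop := @coprod_is_coproduct I Q.
have [h [hE _]] := cop F g.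
have hepi : kepi h.
  move=> A x; pose i : I := existT _ A x.
  exists (coprod_inj Q i A (qproj (ann x A) (idm A))).
  by rewrite hE [LHS]elem_mapE //; apply: mact1.
apply: (loc_quot hepi); apply: (loc_coprod cop) => i; apply: WF.
Qed.

Lemma loc_ann F A (x : F A) : W F -> W (quot_sieve (ann x)).
Proof. by apply: loc_sub; apply: (@elem_mor_mono F A x (ann x) (fun _ _ => id)). Qed.

Definition loc_cov A (R : sieve A) : Prop := W (quot_sieve R).

Lemma loc_cov_superset A (R S : sieve A) : loc_cov R ->
  (forall A' (f : hom c A' A), R A' f -> S A' f) -> loc_cov S.
Proof.
move=> WR RS.
have RS0 A' (f : hom c A' A) : R A' f ->
    mact f (qproj (S A) (idm A) : quot_sieve S A) = 0.
  by move=> /RS Sf; apply/quot_sieve_ann_idm.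
apply: loc_quot (elem_mor_epi RS0 _) WR; exact: quot_sieve_generated.
Qed.

(** A zero presheaf is a coproduct of the empty family. *)
Lemma loc_zero F : (forall A (x : F A), x = 0) -> W F.
Proof.
move=> F0.
pose E (i : False) : kmod c := match i with end.
pose inj (i : False) : kmor (E i) F := match i with end.
have cop : is_coproduct inj.
  move=> G g; have h0 A : linear (fun _ : F A => 0 : G A).
    by move=> d x y; rewrite scaler0 addr0.
  have hN A' A (f : hom c A' A) (x : F A) : 0 = mact f 0 :> G A'.
    by rewrite mact0.
  exists (KMor h0 hN); split=> [[]|h' _ A y] /=.
  by rewrite (F0 A y) kmap0.
by apply: (loc_coprod cop) => -[].
Qed.

Fact loc_cov_id A : loc_cov (full_sieve A).
Proof.
apply: loc_zero => A' q; rewrite -(qprojK q) quot_sieve_gen.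
exact/quot_sieve_ann_idm.
Qed.

Fact loc_cov_pull A (R : sieve A) : loc_cov R ->
  forall A' (f : hom c A' A), loc_cov (pull_sieve f R).
Proof. by move=> WR A' f; rewrite -ann_quot; apply: loc_ann. Qed.

Section Glueing.
Variables (A : c) (R S : sieve A).

Definition sum_mem A' (f : hom c A' A) : Prop :=
  exists r s, [/\ R A' r, S A' s & f = r + s].

Fact sum_mem0 A' : sum_mem (0 : hom c A' A).
Proof. by exists 0, 0; split; rewrite ?addr0 //; apply: smem0. Qed.

Fact sum_memP A' d (f g : hom c A' A) :
  sum_mem f -> sum_mem g -> sum_mem (d *: f + g).
Proof.
move=> [r [s [Rr Ss ->]]] [r' [s' [Rr' Ss' ->]]].
exists (d *: r + r'), (d *: s + s').
by split; rewrite ?scalerDr 1?addrACA //; apply: smemP.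
Qed.

Fact sum_stable A'' A' (f : hom c A' A) (g : hom c A'' A') :
  sum_mem f -> sum_mem (f \c g).
Proof.
move=> [r [s [Rr Ss ->]]]; exists (r \c g), (s \c g).
by split; rewrite ?(linear_funD (compr_linear g)) //; apply: sv_stable.
Qed.

Definition sum_sieve : sieve A :=
  @Sieve k c A (fun A' => Submod (@sum_mem0 A') (@sum_memP A')) sum_stable.

Definition img_mem A' (q : quot_sieve S A') : Prop :=
  exists2 r, R A' r & q = qproj (S A') r.

Fact img_mem0 A' : img_mem (0 : quot_sieve S A').
Proof.
by exists 0; [apply: smem0|rewrite (linear_fun0 (@qproj_linear _ _ _))].
Qed.

Fact img_memP A' d (q q' : quot_sieve S A') :
  img_mem q -> img_mem q' -> img_mem (d *: q + q').
Proof.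
move=> [r Rr ->] [r' Rr' ->]; exists (d *: r + r'); first exact: smemP.
by rewrite qproj_linear.
Qed.

Definition img_submod A' : submod (quot_sieve S A') :=
  Submod (@img_mem0 A') (@img_memP A').

Lemma img_stable A'' A' (f : hom c A'' A') (q : quot_sieve S A') :
  img_submod A' q -> img_submod A'' (mact f q).
Proof.
by move=> [r Rr ->]; exists (r \c f); [apply: sv_stable|rewrite /= qactE].
Qed.

Lemma sum_sieve_kills A' (f : hom c A' A) : S A' f ->
  mact f (qproj (sum_sieve A) (idm A) : quot_sieve sum_sieve A) = 0.
Proof.
move=> Sf; apply/quot_sieve_ann_idm; exists 0, f.
by split; rewrite ?add0r //; apply: smem0.
Qed.

(** The sequence 0 -> (R + S)/S -> c(-, A)/S -> c(-, A)/(R + S) -> 0, which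
    reduces glueing to closure under extensions; (R + S)/S is realized as the
    image of R. *)
Lemma img_sum_exact :
  short_exact (sub_incl img_stable) (elem_mor sum_sieve_kills).
Proof.
split; first exact: sub_incl_mono.
  by apply: elem_mor_epi; apply: quot_sieve_generated.
move=> A' q; split=> [|[x <-]].
  rewrite -(qprojK q) [elem_mor _ _ _]elem_mapE; last exact: sum_sieve_kills.
  move=> /quot_sieve_ann_idm [r [s [Rr Ss E]]].
  have qr : smemb (img_submod A') (qproj (S A') r).
    by apply/asboolP; exists r.
  exists (Sub _ qr) => /=; rewrite E; apply/qproj_eq.
  by rewrite opprD addNKr -scaleN1r -[_ *: s]addr0; apply/smemP/smem0.
have /asboolP [r Rr E] := valP x.
rewrite [sub_incl _ _ _]E [LHS]elem_mapE; last exact: sum_sieve_kills.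
apply/quot_sieve_ann_idm.
by exists r, 0; split; rewrite ?addr0 //; apply: smem0.
Qed.

(** In [img_sum_exact] the right-hand term is a quotient of c(-, A)/R, and the
    elements of the left-hand term are the classes of the r in R, whose
    annihilators are the pullbacks of S along r. *)
Fact loc_cov_glue : loc_cov R ->
  (forall A' (f : hom c A' A), R A' f -> loc_cov (pull_sieve f S)) ->
  loc_cov S.
Proof.
move=> WR WS; apply: (loc_ext img_sum_exact); last first.
  apply: loc_cov_superset WR _ => A' f Rf; exists f, 0.
  by split; rewrite ?addr0 //; apply: smem0.
apply: loc_mem_ann => A' x.
have /asboolP [r Rr E] := valP x.
apply: loc_cov_superset (WS _ _ Rr) _ => A'' g; rewrite -ann_quot -E => gx.
exact: val_inj.
Qed.

End Glueing.

Definition loc_top : topology c :=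
  Topology loc_cov_id loc_cov_pull loc_cov_glue.

Lemma null_loc_top F : null_presheaf loc_top F -> W F.
Proof. by move=> /null_presheafE; apply: loc_mem_ann. Qed.

End LocalizingTopology.
End Presheaves.

(** * The tensor product *)

Section Box.
Context {k : comPzRingType} {a b : klincat k}.
Local Notation ab := (tensor_cat a b).

Lemma box_sieve_pure A B (R : sieve A) (S : sieve B) (X : ab)
    (f : hom a X.1 A) (g : hom b X.2 B) :
  R X.1 f -> S X.2 g -> box_sieve R S X (pure f g : hom ab X (A, B)).
Proof.
move=> Rf Sg.
have Rf' : smemb (R X.1) f by apply/asboolP.
have Sg' : smemb (S X.2) g by apply/asboolP.
by exists (pure (Sub _ Rf') (Sub _ Sg')); rewrite /box_map tmapE.
Qed.

(** The values of a box sieve are spanned by the pure tensors of elements of the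
    two sieves. *)
Lemma box_sieve_ind A B (R : sieve A) (S : sieve B) (X : ab)
    (U : submod (hom ab X (A, B))) :
  (forall f g, R X.1 f -> S X.2 g -> U (pure f g : hom ab X (A, B))) ->
  forall t, box_sieve R S X t -> U t.
Proof.
move=> UP _ [t <-].
have lt : linear (box_map (R := R) (S := S) (X := X)) by apply: tmap_linear.
elim/(@tensor_ind k (smod (R X.1)) (smod (S X.2))): t => [|r s t IHt].
  by rewrite (linear_fun0 lt); apply: smem0.
rewrite (linear_funD lt) -[box_map (pure r s)]scale1r; apply: smemP IHt.
rewrite /box_map tmapE //.
by apply: UP; apply/asboolP; [apply: (valP r)|apply: (valP s)].
Qed.

Lemma pure_factorl (X : ab) A B (f : hom a X.1 A) (g : hom b X.2 B) :
  (pure f g : hom ab X (A, B)) =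
  (pure f (idm B) : hom ab (X.1, B) (A, B)) \c
  (pure (idm X.1) g : hom ab X (X.1, B)).
Proof. by rewrite [RHS]tcomp_pure compm1 comp1m. Qed.

Lemma pure_factorr (X : ab) A B (f : hom a X.1 A) (g : hom b X.2 B) :
  (pure f g : hom ab X (A, B)) =
  (pure (idm A) g : hom ab (A, X.2) (A, B)) \c
  (pure f (idm X.2) : hom ab X (A, X.2)).
Proof. by rewrite [RHS]tcomp_pure compm1 comp1m. Qed.

Section Tops.
Variables (Ta : topology a) (Tb : topology b).

(** A pure tensor f ⊗ g acts on x by f ⊗ 1 first, which kills x when f is in
    R. *)
Lemma null_of_resl (F : kmod ab) : (forall B, null_presheaf Ta (resl F B)) ->
  null_presheaf (box_top Ta Tb) F.
Proof.
move=> nF [A B] x; have [R TR Rx] := nF B A x.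
exists (box_sieve R (full_sieve B)).
  by move=> T PT; apply: PT; apply: BoxGenL.
move=> X t; apply: (box_sieve_ind (U := ann x X)) t => f g Rf _ /=.
rewrite /ann_mem pure_factorl mactM [mact _ x](Rx _ f Rf).
exact: mact0.
Qed.

Lemma null_of_resr (F : kmod ab) : (forall A, null_presheaf Tb (resr F A)) ->
  null_presheaf (box_top Ta Tb) F.
Proof.
move=> nF [A B] x; have [S TS Sx] := nF A B x.
exists (box_sieve (full_sieve A) S).
  by move=> T PT; apply: PT; apply: BoxGenR.
move=> X t; apply: (box_sieve_ind (U := ann x X)) t => f g _ Sg /=.
rewrite /ann_mem pure_factorr mactM [mact _ x](Sx _ g Sg).
exact: mact0.
Qed.

(** Null elements form a submodule, so it suffices to treat the class of a pure
    tensor f ⊗ g: precomposing with h ⊗ 1 gives f h ⊗ g, which lies in the box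
    sieve as soon as f h is in R. *)
Lemma null_resl_quot_box A B (R : sieve A) (B' : b) : Ta A R ->
  null_presheaf Ta (resl (quot_sieve (box_sieve R (full_sieve B))) B').
Proof.
move=> TR; set F := resl _ _; apply/null_presheafE => A' q.
suff: null_submod Ta F A' q by [].
rewrite -(qprojK q).
elim/(@thom_ind k a b (A', B') (A, B)): (repr _) => [|f g t IHt].
  by rewrite (linear_fun0 (@qproj_linear _ _ _)); apply: smem0.
rewrite qprojD -[X in _ (X + _)]scale1r; apply: smemP IHt.
apply: cov_superset (cov_pull TR f) _ => A'' h Rfh.
rewrite /= /ann_mem /= /resl_act /= qactE.
rewrite -(linear_fun0 (@qproj_linear _ _ _)); apply/qproj_eq; rewrite subr0.
by rewrite [_ \c _]tcomp_pure; apply: box_sieve_pure.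
Qed.

Lemma null_resr_quot_box A B (S : sieve B) (A' : a) : Tb B S ->
  null_presheaf Tb (resr (quot_sieve (box_sieve (full_sieve A) S)) A').
Proof.
move=> TS; set F := resr _ _; apply/null_presheafE => B' q.
suff: null_submod Tb F B' q by [].
rewrite -(qprojK q).
elim/(@thom_ind k a b (A', B') (A, B)): (repr _) => [|f g t IHt].
  by rewrite (linear_fun0 (@qproj_linear _ _ _)); apply: smem0.
rewrite qprojD -[X in _ (X + _)]scale1r; apply: smemP IHt.
apply: cov_superset (cov_pull TS g) _ => B'' h Sgh.
rewrite /= /ann_mem /= /resr_act /= qactE.
rewrite -(linear_fun0 (@qproj_linear _ _ _)); apply/qproj_eq; rewrite subr0.
by rewrite [_ \c _]tcomp_pure; apply: box_sieve_pure.
Qed.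

End Tops.
End Box.

Theorem corollary2p19 (k : comPzRingType) (a b : klincat k)
    (Ta : topology a) (Wa : localizing a) (hTWa : corresponds Ta Wa)
    (Tb : topology b) (Wb : localizing b) (hTWb : corresponds Tb Wb) :
  corresponds (box_top Ta Tb) (box_loc Wa Wb).
Proof.
have [Wa_null _] := hTWa; have [Wb_null _] := hTWb.
have locE F : box_loc Wa Wb F <-> null_presheaf (box_top Ta Tb) F.
  split=> [WF|nF].
    apply: (WF (null_loc (box_top Ta Tb))) => G [G1|G2].
      by apply: null_of_resl => B; apply/Wa_null.
    by apply: null_of_resr => A; apply/Wb_null.
  apply: null_loc_top => X x; have [R TR Rx] := nF X x; exists R => //.
  have gen G : loc1 Wa G \/ loc2 Wb G -> box_loc Wa Wb G.
    by move=> WG; rewrite /box_loc /= => W; apply.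
  apply: (TR (loc_top (box_loc Wa Wb))) => _ _ [A B Q TQ|A B Q TQ]; apply: gen.
    by left=> B'; apply/Wa_null; exact: null_resl_quot_box.
  by right=> A'; apply/Wb_null; exact: null_resr_quot_box.
split=> // X R; rewrite locE; exact: cov_null_quot.
Qed.
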